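(* Let $(x^k,y^k)$ be a sequence generated by the general primal-dual algorithm with linesearch described in the context, applied to $\min_{x\in X}\max_{y\in Y}\langle Kx,y\rangle+g(x)-f^*(y)-h(y)$. Then the sequences $(x^k)$ and $(y^k)$ converge to a saddle point of this problem, i.e. $(x^k,y^k)$ converges to a saddle point.
   Context: Setting: $X,Y$ are finite-dimensional real inner product spaces with norms $\|\cdot\|=\sqrt{\langle\cdot,\cdot\rangle}$; $K\colon X\to Y$ is a bounded linear operator with adjoint $K^*$; $g\colon X\to(-\infty,+\infty]$ and $f^*\colon Y\to(-\infty,+\infty]$ are proper lower semicontinuous convex functions ($f^*$ is the Legendre–Fenchel conjugate of a convex lower semicontinuous function $f$); $h\colon Y\to\mathbb R$ is a smooth convex function whose gradient $\nabla h$ is $L_h$-Lipschitz continuous. A saddle point $(\hat x,\hat y)$ of the problem satisfies $g(x)-g(\hat x)+\langle K^*\hat y,x-\hat x\rangle\ge0$ for all $x\in X$ and $f^*(y)+h(y)-f^*(\hat y)-h(\hat y)-\langle K\hat x,y-\hat y\rangle\ge0$ for all $y\in Y$. It is assumed that a saddle point exists. $\operatorname{prox}_\phi(x)=\operatorname{argmin}_z\{\phi(z)+\frac12\|z-x\|^2\}$. Algorithm. Initialization: choose $x^0\in X$, $y^1\in Y$, $\tau_0>0$, $\mu\in(0,1)$, $\delta\in(0,1)$, $\beta>0$; set $\theta_0=1$. For $k=1,2,\dots$: 1. $x^k=\operatorname{prox}_{\tau_{k-1}g}(x^{k-1}-\tau_{k-1}K^*y^k)$. 2. Choose any trial value $\tau_k\in[\tau_{k-1},\tau_{k-1}\sqrt{1+\theta_{k-1}}]$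 and run the linesearch: 2.a. compute $\theta_k=\tau_k/\tau_{k-1}$, $\sigma_k=\beta\tau_k$, $\bar x^k=x^k+\theta_k(x^k-x^{k-1})$, $y^{k+1}=\operatorname{prox}_{\sigma_kf^*}\bigl(y^k+\sigma_k(K\bar x^k-\nabla h(y^k))\bigr)$; 2.b. if $$\tau_k\sigma_k\|K^*y^{k+1}-K^*y^k\|^2+2\sigma_k\bigl[h(y^{k+1})-h(y^k)-\langle\nabla h(y^k),y^{k+1}-y^k\rangle\bigr]\le\delta\|y^{k+1}-y^k\|^2,$$ stop the linesearch (keeping the current $\tau_k,\theta_k,\sigma_k,\bar x^k,y^{k+1}$); otherwise replace $\tau_k$ by $\mu\tau_k$ and return to 2.a. *)

(* Defs.v *)
From HB Require Import structures.
From mathcomp Require Import all_boot all_order all_algebra.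
From mathcomp Require Import all_classical all_reals all_analysis.

Set Implicit Arguments.
Unset Strict Implicit.
Unset Printing Implicit Defensive.

Import Order.TTheory GRing.Theory Num.Theory.
Import numFieldNormedType.Exports.

Local Open Scope classical_set_scope.
Local Open Scope ring_scope.

Section inner_product_spaces.
Context (R : realType).
Implicit Types X Y : normedModType R.

(* A finite-dimensional real inner product space is a normed module [X] with a
   positive definite symmetric bilinear form [dot : {dot X for idfun}] inducing
   its norm, and with a finite spanning family. *)
Definition norm_induced_by X (dot : {dot X for idfun}) : Prop :=
  forall x, `|x| = Num.sqrt (dot x x).

Definition finite_dimensional X : Prop :=
  exists (n : nat) (e : 'I_n -> X), forall x : X,
    exists c : 'I_n -> R, x = \sum_(i < n) c i *: e i.

Definition is_adjoint X Y (dotX : {dot X for idfun}) (dotY : {dot Y for idfun})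
    (K : X -> Y) (Ks : Y -> X) : Prop :=
  forall x y, dotY (K x) y = dotX x (Ks y).

(* [dh] is the gradient of [h]: [h] is everywhere Frechet differentiable and
   [dh y] is the Riesz representative of its differential at [y]. *)
Definition is_gradient Y (dot : {dot Y for idfun}) (h : Y -> R) (dh : Y -> Y)
    : Prop :=
  forall y, differentiable h y /\ forall v, 'd h y v = dot (dh y) v.

End inner_product_spaces.

Section extended_real_functions.
Context (R : realType) (X : normedModType R).
Implicit Types phi : X -> \bar R.

Definition proper_function phi : Prop :=
  (forall x, phi x != -oo%E) /\ exists x, (phi x < +oo)%E.

(* In [\bar R], [0 * +oo = 0] and [+oo - oo = -oo]; the latter sum does not
   occur on the right-hand side for functions that avoid [-oo]. *)
Definition convex_efunction phi : Prop :=
  forall (x y : X) (t : R), 0 <= t <= 1 ->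
    (phi (t *: x + (1 - t) *: y)%R <= t%:E * phi x + (1 - t)%:E * phi y)%E.

Definition fenchel_conjugate (dot : {dot X for idfun}) phi : X -> \bar R :=
  fun y => ereal_sup [set ((dot y x)%:E - phi x)%E | x in [set: X]].

(* [p = prox_phi x], i.e. [p] minimizes [phi z + |z - x|^2 / 2]. For a proper
   convex lower semicontinuous [phi] this minimizer exists and is unique. *)
Definition is_prox phi (x p : X) : Prop :=
  forall z, (phi p + (2^-1 * `|p - x| ^+ 2)%:E <=
             phi z + (2^-1 * `|z - x| ^+ 2)%:E)%E.

End extended_real_functions.

Section primal_dual.
Context (R : realType) (X Y : normedModType R).
Context (dotX : {dot X for idfun}) (dotY : {dot Y for idfun}).
Context (K : X -> Y) (Ks : Y -> X).
Context (g : X -> \bar R) (fs : Y -> \bar R) (h : Y -> R) (dh : Y -> Y).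

(* Since [+oo - oo = -oo] in [\bar R], for proper [g] and [fs] these
   inequalities force [g xh] and [fs yh] to be finite. *)
Definition saddle_point (xh : X) (yh : Y) : Prop :=
  (forall x, 0 <= g x - g xh + (dotX (Ks yh) (x - xh)%R)%:E)%E /\
  (forall y, 0 <= fs y + (h y)%:E - fs yh - (h yh)%:E
                  - (dotY (K xh) (y - yh)%R)%:E)%E.

Context (beta mu delta : R).

(* The point [y'] computed from [x^{k-1}, x^k, y^k, tau_{k-1}] for the trial
   value [tau] of [tau_k]. *)
Definition trial_step (x0 x1 : X) (y1 : Y) (tau0 tau : R) (y' : Y) : Prop :=
  let theta := tau / tau0 in
  let sigma := beta * tau in
  let xbar := x1 + theta *: (x1 - x0) in
  is_prox (fun z => sigma%:E * fs z)%E (y1 + sigma *: (K xbar - dh y1)) y'.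

Definition stopping_test (y1 : Y) (tau : R) (y' : Y) : Prop :=
  let sigma := beta * tau in
  tau * sigma * `|Ks y' - Ks y1| ^+ 2
  + 2 * sigma * (h y' - h y1 - dotY (dh y1) (y' - y1))
  <= delta * `|y' - y1| ^+ 2.

(* A terminating linesearch with outcome [tau_k = tau1] and [y^{k+1} = y2]: the
   trial values are [t 0, ..., t n], all of them but the last one rejected. *)
Definition linesearch (x0 x1 : X) (y1 : Y) (tau0 theta0 tau1 : R) (y2 : Y)
    : Prop :=
  exists (n : nat) (t : nat -> R) (w : nat -> Y),
    [/\ tau0 <= t 0%N <= tau0 * Num.sqrt (1 + theta0),
        forall i, (i < n)%N -> t i.+1 = mu * t i,
        forall i, (i <= n)%N -> trial_step x0 x1 y1 tau0 (t i) (w i),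
        forall i, (i < n)%N -> ~ stopping_test y1 (t i) (w i) &
        [/\ stopping_test y1 (t n) (w n), tau1 = t n & y2 = w n]].

(* The dual iterates are [y 1, y 2, ...]; the value [y 0] plays no role. *)
Record generated_by_PDAL (x : nat -> X) (y : nat -> Y) (tau theta : nat -> R)
    : Prop := {
  pdal_tau0 : 0 < tau 0%N ;
  pdal_theta0 : theta 0%N = 1 ;
  pdal_primal : forall k, (0 < k)%N ->
    is_prox (fun z => (tau k.-1)%:E * g z)%E
            (x k.-1 - tau k.-1 *: Ks (y k)) (x k) ;
  pdal_linesearch : forall k, (0 < k)%N ->
    linesearch (x k.-1) (x k) (y k) (tau k.-1) (theta k.-1)
               (tau k) (y k.+1) ;
  pdal_theta : forall k, (0 < k)%N -> theta k = tau k / tau k.-1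
}.

End primal_dual.

(* Main.v *)
Require Import Defs.
From HB Require Import structures.
From mathcomp Require Import all_boot all_order all_algebra.
From mathcomp Require Import all_classical all_reals all_analysis.
From mathcomp Require Import ring lra.
Set Implicit Arguments.
Unset Strict Implicit.
Unset Printing Implicit Defensive.
Import Order.TTheory GRing.Theory Num.Theory.
Import numFieldNormedType.Exports.
Local Open Scope classical_set_scope.
Local Open Scope ring_scope.

(** Let [W_k] be [beta |x^k - xh|^2 + |y^k - yh|^2 + 2 beta T_{k-1}] with
    [T_k = tau_k (1 + theta_k) P(x^k)], where [P] is the primal gap at the saddle
    point [(xh, yh)]. The prox inequalities and the stopping test give
      [W_{k+1} + beta |theta_k (x^k - x^{k-1})|^2 + (1 - delta) |y^{k+1} - y^k|^2
       + 2 beta r_k T_{k-1} <= W_k],  [r_k = 1 - theta_k^2 / (1 + theta_{k-1})],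
    so the iterates are bounded and, as [tau_k] is bounded away from 0, all their
    cluster points are saddle points.
    It remains to find a saddle point [(xs, ys)] for which some subsequence of
    [W_k] tends to 0. This needs [T_{k-1} -> 0] along the subsequence, although
    [g] need not be continuous on its domain and [tau_k] may be unbounded.
    If [sum r_k = +oo], then for every saddle point [sum r_k T_{k-1} < +oo], so
    [T_{k-1} -> 0] outside a set of indices of finite mass for the weights [r_k];
    the complements of such sets form a proper filter, and we take [(xs, ys)] to
    be a cluster point along this filter.
    If [sum r_k < +oo], then [theta_k] is eventually at least [6/5], so [tau_k]
    grows geometrically. Since [tau_k |K^*(y^{k+1} - y^k)| <= C |y^{k+1} - y^k|]
    by the stopping test, [tau_k |K^*(y^k - ys)| -> 0] for any cluster point, and
    the prox inequality at [x^k] tested with [xs] yields [T_k -> 0]. *)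

(** * Inner products, ultrafilter limits and convex functions *)

Section InnerProduct.
Context (R : realType) (X : normedModType R) (dot : {dot X for idfun}).
Implicit Types u v w : X.

Lemma dotC u v : dot u v = dot v u.
Proof. by rewrite hermC expr0 mul1r. Qed.

Lemma dotDl u v w : dot (u + v) w = dot u w + dot v w.
Proof. exact: linearDl. Qed.

Lemma dotDr u v w : dot w (u + v) = dot w u + dot w v.
Proof. exact: linearDr. Qed.

Lemma dotZl a u v : dot (a *: u) v = a * dot u v.
Proof. exact: linearZl_LR. Qed.

Lemma dotZr a u v : dot u (a *: v) = a * dot u v.
Proof. by rewrite dotC dotZl dotC. Qed.

Lemma dotNl u v : dot (- u) v = - dot u v.
Proof. exact: linearNl. Qed.

Lemma dotNr u v : dot u (- v) = - dot u v.
Proof. exact: linearNr. Qed.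

Lemma dot_suml (I : Type) (r : seq I) (F : I -> X) v :
  dot (\sum_(i <- r) F i) v = \sum_(i <- r) dot (F i) v.
Proof. exact: linear_sumlz. Qed.

Lemma dot_sumr (I : Type) (r : seq I) (F : I -> X) v :
  dot v (\sum_(i <- r) F i) = \sum_(i <- r) dot v (F i).
Proof. exact: linear_sumr. Qed.

Definition dotE := (dotDl, dotDr, dotNl, dotNr, dotZl, dotZr).

Lemma dot_gt0 u : u != 0 -> 0 < dot u u.
Proof. exact: neq0_dnorm_gt0. Qed.

Lemma dot_ge0 u : 0 <= dot u u.
Proof.
have [->|/dot_gt0/ltW//] := eqVneq u 0.
by rewrite -(scale0r (0 : X)) dotZl mul0r.
Qed.

Context (normE : norm_induced_by dot).

Lemma sqr_normE u : `|u| ^+ 2 = dot u u.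
Proof. by rewrite normE sqr_sqrtr// dot_ge0. Qed.

Lemma dot_le_norm u v : `|dot u v| <= `|u| * `|v|.
Proof.
rewrite -(@ler_pXn2r _ 2)// ?nnegrE ?mulr_ge0// exprMn !sqr_normE.
rewrite real_normK ?num_real//.
have [->|/dot_gt0 v0] := eqVneq v 0.
  by rewrite -(scale0r (0 : X)) !dotZr !mul0r mulr0 expr0n.
(* The squared norm of this vector is [dot v v] times the defect in the Cauchy-Schwarz
   inequality. *)
have := dot_ge0 (dot v v *: u - dot u v *: v).
rewrite !dotE (dotC v u) => h.
rewrite -subr_ge0 -(pmulr_rge0 _ v0).
by apply: le_trans h _; rewrite le_eqVlt; apply/orP; left; apply/eqP; ring.
Qed.

End InnerProduct.

Section OrthogonalExpansion.
Context (R : realType) (X : normedModType R) (dot : {dot X for idfun}).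
Context (normE : norm_induced_by dot).

(* Gram-Schmidt; the first clause replaces orthonormality of [r] by the fact that
   each of its elements is fixed by the orthogonal projection. *)
Lemma parseval_seq_exists (s : seq X) : exists r : seq X,
  (forall x, x \in r -> x = \sum_(u <- r) dot x u *: u) /\
  (forall x, x \in s -> x = \sum_(u <- r) dot x u *: u).
Proof.
elim: s => [|e s [r [rr rs]]]; first by exists [::].
set Q := fun x => \sum_(u <- r) dot x u *: u.
have Qsym a b : dot (Q a) b = dot a (Q b).
  rewrite /Q dot_suml dot_sumr; apply: eq_bigr => u _.
  by rewrite dotZl dotZr (dotC dot u b) mulrC.
have [v0|v0] := eqVneq (e - Q e) 0.
  exists r; split=> // x; rewrite inE => /orP[/eqP ->|/rs//].
  by apply/eqP; rewrite -subr_eq0 -/(Q e) v0.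
set v := e - Q e in v0.
(* [Q] is symmetric and fixes every [u] in [r], so the residual [v] of [e] is orthogonal to [r]. *)
have vr u : u \in r -> dot v u = 0.
  by move=> ur; rewrite /v dotDl dotNl Qsym [Q u](_ : _ = u) ?subrr//; apply/esym/rr.
have n0 : `|v| != 0 by rewrite normr_eq0.
set w := `|v|^-1 *: v.
have wr u : u \in r -> dot w u = 0 by move=> ur; rewrite dotZl vr// mulr0.
have Qw a : dot (Q a) w = 0.
  rewrite /Q dot_suml big_seq big1// => u ur.
  by rewrite dotZl (dotC dot u w) wr// mulr0.
have Qw0 : Q w = 0.
  by rewrite /Q big_seq big1// => u ur; rewrite wr// scale0r.
have ww : dot w w = 1.
  by rewrite /w dotZl dotZr -(sqr_normE normE) expr2; field.
exists (w :: r); split=> x; rewrite inE => /orP[/eqP ->|xr]; rewrite big_cons -/(Q _).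
- by rewrite ww scale1r Qw0 addr0.
- by rewrite (dotC dot x w) wr// scale0r add0r; apply: rr.
- have -> : dot e w = `|v|.
    have -> : e = v + Q e by rewrite subrK.
    rewrite dotDl Qw addr0 /w dotZr -(sqr_normE normE) expr2.
    by field.
  by rewrite /w scalerA divff// scale1r subrK.
- have -> : dot x w = 0 by rewrite (rs _ xr) Qw.
  by rewrite scale0r add0r; apply: rs.
Qed.

(** Unlike the coefficients over an arbitrary spanning family, those over this Parseval frame are
    controlled by the norm of [x], as compactness requires. *)
Lemma finite_dimensional_parseval : finite_dimensional X ->
  exists r : seq X, forall x, x = \sum_(u <- r) dot x u *: u.
Proof.
move=> [n [e eX]].
have [r [_ rs]] := parseval_seq_exists [seq e i | i <- enum 'I_n].
exists r => x; have [c xE] := eX x.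
rewrite {1}xE {1}(eq_bigr (fun i => \sum_(u <- r) (c i * dot (e i) u) *: u)).
  rewrite exchange_big; apply: eq_bigr => u _ /=.
  rewrite xE dot_suml scaler_suml; apply: eq_bigr => i _.
  by rewrite dotZl.
move=> i _; rewrite {1}(rs (e i)) ?map_f ?mem_enum// scaler_sumr.
by apply: eq_bigr => u _; rewrite scalerA.
Qed.

(** Compactness of [[- M, M]] gives a cluster point, and an ultrafilter converges to its cluster
    points since it contains each set or its complement. *)
Lemma ultra_bounded_cvgR (T : Type) (U : set_system T) (a : T -> R) (M : R) :
  UltraFilter U -> (\forall t \near U, `|a t| <= M) ->
  exists l : R, a t @[t --> U] --> l.
Proof.
move=> UU aM.
have aI : (a t @[t --> U]) `[- M, M]%classic.
  by apply: filterS aM => t; rewrite /= in_itv/= ler_norml.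
have [l [_ cl]] := @segment_compact _ _ _ _ _ aI.
exists l => V lV; have [//|UVC] := in_ultra_setVsetC (a @^-1` V) UU.
by have [z []] := cl (~` V) V UVC lV.
Qed.

Lemma ultra_bounded_cvg (T : Type) (U : set_system T) (x : T -> X) (M : R) :
  finite_dimensional X -> UltraFilter U ->
  (\forall t \near U, `|x t| <= M) -> exists l : X, x t @[t --> U] --> l.
Proof.
move=> /finite_dimensional_parseval[r rE] UU xM.
have xE : x = fun t => \sum_(u <- r) dot (x t) u *: u.
  by apply/funext => t; apply: rE.
(* The induction runs over an arbitrary list because the expansion identity is special to [r]. *)
suff H : forall s : seq X, exists l : X,
  (\sum_(u <- s) dot (x t) u *: u) @[t --> U] --> l.
  by have [l] := H r; exists l; rewrite xE.
elim=> [|u s [l ls]].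
  exists 0; under eq_fun do rewrite big_nil; exact: cvg_cst.
have [b bu] : exists b : R, dot (x t) u @[t --> U] --> b.
  apply: (@ultra_bounded_cvgR _ _ _ (M * `|u|)).
  apply: filterS xM => t xtM; apply: le_trans (dot_le_norm normE _ _) _.
  by rewrite ler_wpM2r.
exists (b *: u + l).
under eq_fun do rewrite big_cons.
by apply: cvgD => //; apply: cvgZr_tmp.
Qed.

Lemma cvg_dot (T : Type) (F : set_system T) {FF : Filter F}
    (u v : T -> X) (a b : X) :
  u t @[t --> F] --> a -> v t @[t --> F] --> b ->
  dot (u t) (v t) @[t --> F] --> dot a b.
Proof.
move=> ua vb.
have ->: (fun t => dot (u t) (v t)) = (fun t => dot (u t - a) (v t) + dot a (v t - b) + dot a b).
  by apply/funext => t; rewrite !dotE; ring.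
rewrite -[X in _ --> X]add0r; apply: cvgD; last exact: cvg_cst.
rewrite -[X in _ --> X]add0r; apply: cvgD; apply/norm_cvg0P.
  have h: `|u t - a| * `|v t| @[t --> F] --> (0 * `|b|).
    apply: cvgM; last exact: cvg_norm.
    by apply/norm_cvg0P; rewrite -(subrr a); apply: cvgB => //; exact: cvg_cst.
  rewrite mul0r in h.
  apply: (squeeze_cvgr _ (cvg_cst 0) h).
  by apply: nearW => t; rewrite normr_ge0/= (dot_le_norm normE).
have h: `|a| * `|v t - b| @[t --> F] --> (`|a| * 0).
  apply: cvgM; first exact: cvg_cst.
  by apply/norm_cvg0P; rewrite -(subrr b); apply: cvgB => //; exact: cvg_cst.
rewrite mulr0 in h.
apply: (squeeze_cvgr _ (cvg_cst 0) h).
by apply: nearW => t; rewrite normr_ge0/= (dot_le_norm normE).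
Qed.

End OrthogonalExpansion.

Section ConvexAnalysis.
Context (R : realType) (X : normedModType R) (dot : {dot X for idfun}).
Context (normE : norm_induced_by dot).

(** Lets the prox inequalities pass to the limit without continuity of [phi]: a level [a] strictly
    between [l] and [phi xs] would eventually lie above [b t] and below [phi (x t)]. *)
Lemma lsc_le_lim (phi : X -> \bar R) (T : Type) (F : set_system T)
    {FF : ProperFilter F} (x : T -> X) (b : T -> R) (xs : X) (l : R) :
  lower_semicontinuous phi ->
  x t @[t --> F] --> xs -> b t @[t --> F] --> l ->
  (\forall t \near F, (phi (x t) <= (b t)%:E)%E) -> (phi xs <= l%:E)%E.
Proof.
move=> lsc xxs bl xb; rewrite leNgt; apply/negP => lphi.
have [a la aphi] : exists2 a : R, l < a & (a%:E < phi xs)%E.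
  case: (phi xs) lphi => [r| |]//.
    by rewrite lte_fin => /midf_lt[? ?]; exists ((l + r) / 2).
  by exists (l + 1); [rewrite ltrDl|rewrite ltry].
have [V Vxs Va] := lsc _ _ aphi.
have bF : \forall t \near F, b t < a by apply: (cvgr_lt l).
have VF : \forall t \near F, V (x t) := xxs _ Vxs.
have [t [[Vt bt] xbt]] := filter_ex (filterI (filterI VF bF) xb).
by have := lt_le_trans (Va _ Vt) xbt; rewrite lte_fin ltNge (ltW bt).
Qed.

Lemma ler_of_small_perturbation (a b c : R) : 0 <= c ->
  (forall t, 0 < t <= 1 -> a <= b + t * c) -> a <= b.
Proof.
move=> c0 H; rewrite leNgt; apply/negP => ab.
have d0 : 0 < a - b by rewrite subr_gt0.
have d1 : 0 < a - b + c by rewrite ltr_wpDr.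
(* With [d = a - b] and [t = d / (d + c)], the bound [d <= t * c] forces [d ^ 2 <= 0]. *)
have t01 : 0 < (a - b) / (a - b + c) <= 1.
  by rewrite divr_gt0//= ler_pdivrMr// mul1r lerDl.
have := H _ t01.
rewrite -lerBlDl mulrAC ler_pdivlMr// => h.
have : (a - b) * (a - b) > 0 by rewrite mulr_gt0.
by nra.
Qed.

Lemma proper_fin_num (phi : X -> \bar R) (z : X) :
  proper_function phi -> (phi z < +oo)%E -> phi z \is a fin_num.
Proof. by move=> [phiN _] zoo; rewrite fin_numE phiN/= -ltey. Qed.

Lemma prox_fin_num (phi : X -> \bar R) (tau : R) (x p : X) :
  proper_function phi -> 0 < tau ->
  is_prox (fun z => tau%:E * phi z)%E x p -> phi p \is a fin_num.
Proof.
move=> pphi tau0 pr; apply: proper_fin_num => //.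
have [phiN [z zoo]] := pphi.
have := pr z; rewrite -(fineK (proper_fin_num pphi zoo)).
have := phiN p; case: (phi p) => [r| |]//; rewrite ?ltry// => _.
by rewrite mulry gtr0_sg// mul1e addye// -EFinM -EFinD.
Qed.

(** The minimizer [p] is compared with [t z + (1 - t) p]; after division by [t] the remaining
    quadratic term is of order [t]. *)
Lemma prox_variational (phi : X -> \bar R) (tau : R) (x p z : X) :
  proper_function phi -> convex_efunction phi -> 0 < tau ->
  is_prox (fun z => tau%:E * phi z)%E x p -> phi z \is a fin_num ->
  tau * (fine (phi p) - fine (phi z)) <= dot (p - x) (z - p).
Proof.
move=> pphi cphi tau0 pr zfin.
have pfin := prox_fin_num pphi tau0 pr.
set r := fine (phi p); set s := fine (phi z).
have rE : phi p = r%:E by rewrite fineK.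
have sE : phi z = s%:E by rewrite fineK.
apply: (@ler_of_small_perturbation _ _ (2^-1 * dot (z - p) (z - p))).
  by rewrite mulr_ge0// dot_ge0.
move=> t /andP[t0 t1].
have t01 : 0 <= t <= 1 by rewrite ltW.
set w := t *: z + (1 - t) *: p.
have := cphi z p t t01; rewrite sE rE -/w -!EFinM -EFinD => wle.
have wfin : phi w \is a fin_num.
  by apply: proper_fin_num => //; rewrite (le_lt_trans wle)// ltry.
have := pr w; rewrite rE -(fineK wfin) -!EFinM -!EFinD lee_fin.
move: wle; rewrite -(fineK wfin) lee_fin; move: (fine (phi w)) => q qle; rewrite /=.
have -> : w - x = (p - x) + t *: (z - p).
  by rewrite /w scalerBl scale1r scalerBr addrCA addrAC.
rewrite !(sqr_normE normE).
move: (p - x) (z - p) => u v.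
rewrite !dotE (dotC dot v u) => prle.
have := ler_wpM2l (ltW tau0) qle.
by move=> h; rewrite -(ler_pM2l t0); lra.
Qed.

(** The directional derivative is the limit from the right of difference quotients, each at most
    [h z - h y] by convexity. *)
Lemma convex_gradient_le (h : X -> R) (dh : X -> X) (y z : X) :
  convex_function [set: X] h -> is_gradient dot h dh ->
  dot (dh y) (z - y) <= h z - h y.
Proof.
move=> ch gh; have [dify /(_ (z - y)) <-] := gh y.
rewrite -deriveE//.
have := @diff_derivable _ _ _ h y (z - y) dify.
move=> /cvg_dnbhs_at_right hc; apply: (cvgr_to_le hc).
near=> t.
have t0 : 0 < t by near: t; exact: nbhs_right_gt.
have t1 : t <= 1 by near: t; exact: nbhs_right_le.
have t01 : Itv.spec (@Itv.num_sem R) (Itv.Real `[0%Z, 1%Z]) t.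
  by rewrite /= /Itv.num_sem/= num_real/= in_itv/= (ltW t0) t1.
pose t' : {i01 R} := Itv.mk t01.
have := ch t' z y; rewrite !inE => /(_ Logic.I Logic.I).
rewrite convRE.
have -> : conv t' (z : convex_lmodType X) y = t *: z + (1 - t) *: y :> X by [].
rewrite /unstable.onem /= => hle.
have -> : t *: (z - y) + y = t *: z + (1 - t) *: y.
  by rewrite scalerBr scalerBl scale1r -addrA [- _ + _]addrC.
by rewrite /GRing.scale/= ler_pdivrMl//; lra.
Unshelve. all: by end_near.
Qed.

End ConvexAnalysis.

Lemma cvg0_sqr_norm (R : realType) (V : normedModType R) (T : Type)
    (F : set_system T) {FF : Filter F} (c : R) (v : T -> V) :
  0 < c -> c * `|v t| ^+ 2 @[t --> F] --> 0 -> v t @[t --> F] --> 0.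
Proof.
move=> c0 cv; apply/cvgrPdist_le => e e0.
have ce0 : 0 < c * e ^+ 2 by rewrite mulr_gt0 ?exprn_gt0.
have cvle : \forall t \near F, c * `|v t| ^+ 2 <= c * e ^+ 2 by apply: (cvgr_le 0).
apply: filterS cvle => t.
by rewrite sub0r normrN ler_pM2l// ler_pXn2r ?nnegrE// ltW.
Qed.

Lemma bounded_scale_cvg0 (R : realType) (V : normedModType R) (F : set_system nat)
    {FF : Filter F} (r : nat -> R) (M : R) (v : nat -> V) :
  (forall n, `|r n| <= M) -> v n @[n --> F] --> 0 ->
  r n *: v n @[n --> F] --> 0.
Proof.
move=> rM v0; apply/norm_cvg0P.
have hv : M * `|v n| @[n --> F] --> M * 0.
  by apply: cvgM; [exact: cvg_cst|exact/norm_cvg0P].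
rewrite mulr0 in hv; apply: (squeeze_cvgr _ (cvg_cst 0) hv).
by apply: nearW => n; rewrite normr_ge0/= normrZ ler_wpM2r.
Qed.

(** * Descent sequences and filters of sets with summable complement *)

Section Descent.
Context (R : realType).
Implicit Types W d a rho : nat -> R.

Lemma descent_sum W d (n : nat) :
  (forall n, 0 <= W n) -> (forall n, W n.+1 + d n <= W n) ->
  \sum_(i < n) d i <= W 0%N.
Proof.
move=> W0 Wd; apply: (@le_trans _ _ (\sum_(i < n) d i + W n)).
  by rewrite lerDl.
elim: n => [|n IH]; first by rewrite big_ord0 add0r.
apply: le_trans IH; rewrite big_ord_recr/= -addrA lerD2l addrC; exact: Wd.
Qed.

Lemma descent_cvg0 W d :
  (forall n, 0 <= W n) -> (forall n, 0 <= d n) ->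
  (forall n, W n.+1 + d n <= W n) -> d n @[n --> \oo] --> 0.
Proof.
move=> W0 d0 Wd.
have Wn : {homo W : n m / (n <= m)%N >-> m <= n}.
  by apply/nonincreasing_seqP => n; apply: le_trans (Wd n); rewrite lerDl.
have Wc : cvgn W.
  by apply: nonincreasing_is_cvgn => //; exists 0 => _ [n _ <-].
have h : W n - W n.+1 @[n --> \oo] --> limn W - limn W.
  by apply: cvgB => //; rewrite (cvg_shiftS W).
rewrite subrr in h; apply: (squeeze_cvgr _ (cvg_cst 0) h).
by apply: nearW => n; rewrite d0/= lerBrDl.
Qed.

(** One small value found along [U] bounds all later ones; this carries convergence along a filter
    over to the whole sequence. *)
Lemma nonincreasing_cvg0 W (U : set_system nat) {UF : ProperFilter U} :
  (forall n, 0 <= W n) -> {homo W : n m / (n <= m)%N >-> m <= n} ->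
  W n @[n --> U] --> 0 -> W n @[n --> \oo] --> 0.
Proof.
move=> W0 Wn WU; apply/cvgrPdist_le => e e0.
have WU' : \forall n \near U, W n <= e by apply: (cvgr_le 0).
have [N /= WN] := filter_ex WU'.
exists N => // n /= Nn; rewrite sub0r normrN ger0_norm//.
exact: le_trans (Wn _ _ Nn) WN.
Qed.

End Descent.

Section CosummableFilter.
Context (R : realType) (a : nat -> R) (a_ge0 : forall n, 0 <= a n).

(* The sets whose complement has finite mass for the measure on [nat] with
   weights [a]; every set of this filter meets any set of infinite mass. *)
Definition cosummable : set_system nat :=
  [set A : set nat | exists M : R, forall n, \sum_(i < n | val i \notin A) a i <= M].

Lemma cosummable_filter : Filter cosummable.
Proof.
split=> [|A B [M AM] [N BN]|A B AB [M AM]].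
- exists 0 => n; rewrite big1// => i; by rewrite in_setT.
- exists (M + N) => n; apply: le_trans (lerD (AM n) (BN n)).
  rewrite [leLHS]big_mkcond [X in _ <= X + _]big_mkcond.
  rewrite [X in _ <= _ + X]big_mkcond -big_split/=; apply: ler_sum => i _.
  by rewrite in_setI; case: (_ \in A); case: (_ \in B) => /=;
    rewrite ?addr0 ?add0r// lerDl.
- exists M => n; apply: le_trans (AM n).
  rewrite [leLHS]big_mkcond [leRHS]big_mkcond; apply: ler_sum => i _.
  have [iA|_] := boolP (val i \in A).
    by rewrite (_ : val i \in B)// inE; apply: AB; rewrite inE in iA.
  by rewrite /=; case: ifP.
Qed.

Lemma cosummable_proper :
  ~ (exists M, forall n, \sum_(i < n) a i <= M) -> ProperFilter cosummable.
Proof.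
move=> nM; split; last exact: cosummable_filter.
move=> [M aM]; apply: nM; exists M => n; apply: le_trans (aM n).
by rewrite [leRHS]big_mkcond; apply: ler_sum => i _; rewrite in_set0.
Qed.

Lemma cofinite_cosummable : \oo `<=` cosummable.
Proof.
move=> A [N _ NA]; exists (\sum_(i < N) a i) => n.
pose b i := if i \notin A then a i else 0.
have b0 i : 0 <= b i by rewrite /b; case: ifP.
(* Padding to [N + n] terms permits a split at [N] without comparing [n] and [N]; the terms from [N]
   on vanish. *)
apply: (@le_trans _ _ (\sum_(i < N + n) b i)).
  rewrite big_mkcond/= (_ : \sum_(i < n) _ = \sum_(i < n) b i)//.
  by rewrite addnC big_split_ord/= lerDl sumr_ge0.
rewrite big_split_ord/= [X in _ + X]big1 ?addr0.
  by apply: ler_sum => i _; rewrite /b; case: ifP.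
by move=> i _; rewrite /b ifF//; apply/negbF; rewrite inE; apply: NA => /=; rewrite leq_addr.
Qed.

(** Markov's inequality: the indices with [T > e] have mass at most [M / e]. *)
Lemma cosummable_cvg0 (T : nat -> R) (M : R) :
  (forall n, 0 <= T n) -> (forall n, \sum_(i < n) a i * T i <= M) ->
  T n @[n --> cosummable] --> 0.
Proof.
move=> T0 aTM; have FF := cosummable_filter.
apply/cvgrPdist_le => e e0; exists (M / e) => n.
rewrite ler_pdivlMr//; apply: le_trans (aTM n).
rewrite mulr_suml big_mkcond; apply: ler_sum => i _.
case: ifPn => [|_]; last by rewrite mulr_ge0.
rewrite notin_setE/= sub0r normrN ger0_norm// => /negP; rewrite -ltNge => /ltW.
exact: ler_wpM2l.
Qed.

End CosummableFilter.

(** * The energy inequality *)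

Section EnergyInequality.
Context (R : realType) (X Y : normedModType R).
Context (dotX : {dot X for idfun}) (dotY : {dot Y for idfun}).
Context (normX : norm_induced_by dotX) (normY : norm_induced_by dotY).

(* Here [a = x^k - x^{k-1}], [b = x^{k+1} - x^k], [e = x^k - xh],
   [q1, q2, qh = K^* y^k, K^* y^{k+1}, K^* yh], [u = y^{k+1} - y^k],
   [w = y^k - yh], [d = grad h (y^k)] and [s = <xh, K^*(y^{k+1} - yh)>]. *)
Lemma pdal_energy_increment (a b e q1 q2 qh : X) (u w d : Y)
    (s g0 g1 g2 gh f2 fh h1 h2 hh tau0 theta beta delta : R) :
  0 < beta -> 0 < tau0 -> 0 <= theta ->
  tau0 * (g1 - g2) <= dotX (a + tau0 *: q1) b ->
  tau0 * (g1 - g0) <= dotX (a + tau0 *: q1) (- a) ->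
  theta * tau0 * (g2 - gh) <= dotX (b + (theta * tau0) *: q2) (- (e + b)) ->
  beta * (theta * tau0) * (f2 - fh) <=
    - dotY u (u + w) + beta * (theta * tau0) *
      (dotX (e + theta *: a) (q2 - qh) + s - dotY d (u + w)) ->
  - dotY d w <= hh - h1 ->
  (theta * tau0) * (beta * (theta * tau0)) * `|q2 - q1| ^+ 2
    + 2 * (beta * (theta * tau0)) * (h2 - h1 - dotY d u)
    <= delta * `|u| ^+ 2 ->
  0 <= f2 + h2 - fh - hh - s ->
  beta * `|e + b| ^+ 2 + `|u + w| ^+ 2
    + 2 * beta * (theta * tau0 * (1 + theta) * (g1 - gh + dotX qh e))
    + (beta * `|theta *: a| ^+ 2 + (1 - delta) * `|u| ^+ 2)
  <= beta * `|e| ^+ 2 + `|w| ^+ 2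
     + 2 * beta * (theta * tau0 * theta * (g0 - gh + dotX qh (e - a))).
Proof.
move=> b0 t0 th0; rewrite !(sqr_normE normX) !(sqr_normE normY).
(* Young's inequality for the coupling term [<theta a - b, q2 - q1>]; the term in [|q2 - q1|^2] that
   it creates is the one bounded by the stopping test. *)
have := dot_ge0 dotX (theta *: a - b - (theta * tau0) *: (q2 - q1)).
rewrite !dotE.
rewrite ?(dotC dotX b a, dotC dotX e a, dotC dotX e b).
rewrite ?(dotC dotX q1 a, dotC dotX q1 b, dotC dotX q1 e).
rewrite ?(dotC dotX q2 a, dotC dotX q2 b, dotC dotX q2 e, dotC dotX q2 q1).
rewrite ?(dotC dotX qh a, dotC dotX qh b, dotC dotX qh e).
rewrite ?(dotC dotY w u).
move=> sq i1 i2 i3 i4 i5 i6 i7.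
have bth : 0 <= beta * theta by rewrite mulr_ge0 // ltW.
have j0 := ler_wpM2l (ltW b0) sq.
(* The relative weights [theta] and [theta^2] merge the two tests of the prox inequality at [x^k]
   into one in the direction [b - theta a], which is [x^{k+1}] minus the extrapolated point. *)
have j1 := ler_wpM2l bth i1.
have j2 := ler_wpM2l (mulr_ge0 bth th0) i2.
have j3 := ler_wpM2l (ltW b0) i3.
have bt : 0 <= beta * theta * tau0 by rewrite mulr_ge0 // ltW.
have j5 := ler_wpM2l bt i5.
have j7 := ler_wpM2l bt i7.
clear sq i1 i2 i3 i5 i7 bth bt.
lra.
Qed.

End EnergyInequality.

Section SaddlePoints.
Context (R : realType) (X Y : normedModType R).
Context (dotX : {dot X for idfun}) (dotY : {dot Y for idfun}).
Context (K : X -> Y) (Ks : Y -> X).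
Context (g : X -> \bar R) (fs : Y -> \bar R) (h : Y -> R).
Context (properg : proper_function g) (properfs : proper_function fs).

Definition primal_gap (xh : X) (yh : Y) (x : X) : R :=
  fine (g x) - fine (g xh) + dotX (Ks yh) (x - xh).

Definition dual_gap (xh : X) (yh y : Y) : R :=
  fine (fs y) + h y - fine (fs yh) - h yh - dotY (K xh) (y - yh).

(** Passes to real arithmetic. A test at a point of the domain excludes [g xh = +oo], since the
    difference would be [-oo]; conversely, test points outside the domain give [+oo]. *)
Lemma saddle_pointP (xh : X) (yh : Y) :
  saddle_point dotX dotY K Ks g fs h xh yh <->
  [/\ g xh \is a fin_num, fs yh \is a fin_num,
      forall x, g x \is a fin_num -> 0 <= primal_gap xh yh x &
      forall y, fs y \is a fin_num -> 0 <= dual_gap xh yh y].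
Proof.
have [gN [x0 gx0]] := properg; have [fN [y0 fy0]] := properfs.
split=> [[sx sy]|[gxh fyh sx sy]].
  have gxh : g xh \is a fin_num.
    apply: proper_fin_num => //; rewrite ltey; apply/eqP => gxh.
    have := sx x0; rewrite gxh.
    by case: (g x0) (gN x0).
  have fyh : fs yh \is a fin_num.
    apply: proper_fin_num => //; rewrite ltey; apply/eqP => fyh.
    have := sy y0; rewrite fyh.
    by case: (fs y0) (fN y0).
  split=> // [x gx|y fy].
    have := sx x; rewrite -{1}(fineK gx) -{1}(fineK gxh).
    by rewrite -EFinB -EFinD lee_fin.
  have := sy y; rewrite -{1}(fineK fy) -{1}(fineK fyh).
  by rewrite -!EFinD lee_fin.
split=> [x|y].
  have [gx|gx] := boolP (g x \is a fin_num).
    rewrite -{1}(fineK gx) -{1}(fineK gxh) -EFinB -EFinD lee_fin; exact: sx.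
  move: gx (gN x); rewrite -(fineK gxh); case: (g x) => [r| |]// _ _.
  by rewrite !addye.
have [fy|fy] := boolP (fs y \is a fin_num).
  rewrite -{1}(fineK fy) -{1}(fineK fyh) -!EFinD lee_fin; exact: sy.
move: fy (fN y); rewrite -(fineK fyh); case: (fs y) => [r| |]// _ _.
by rewrite !addye.
Qed.

End SaddlePoints.

(** * Step sizes and one-step inequalities of the iterates *)

Section PDAL.
Context (R : realType) (X Y : normedModType R).
Context (dotX : {dot X for idfun}) (dotY : {dot Y for idfun}).
Context (normX : norm_induced_by dotX) (normY : norm_induced_by dotY).
Context (K : {linear X -> Y}) (Ks : {linear Y -> X}).
Context (adjK : is_adjoint dotX dotY K Ks).
Context (kn : R) (kn_ge0 : 0 <= kn) (Ks_le : forall v, `|Ks v| <= kn * `|v|).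
Context (K_cont : continuous K).
Context (g : X -> \bar R) (properg : proper_function g).
Context (convexg : convex_efunction g) (lscg : lower_semicontinuous g).
Context (fs : Y -> \bar R) (properfs : proper_function fs).
Context (convexfs : convex_efunction fs) (lscfs : lower_semicontinuous fs).
Context (h : Y -> R) (dh : Y -> Y) (L : R) (L_ge0 : 0 <= L).
Context (grad_le : forall y z, dotY (dh y) (z - y) <= h z - h y).
Context (dh_lip : forall y z, `|dh y - dh z| <= L * `|y - z|).
Context (beta mu delta : R).
Context (beta_gt0 : 0 < beta) (mu01 : 0 < mu < 1) (delta01 : 0 < delta < 1).
Context (x : nat -> X) (y : nat -> Y) (tau theta : nat -> R).
Context (xyP : generated_by_PDAL dotY K Ks g fs h dh beta mu delta x y tau theta).

Lemma linesearch_pos_le (n : nat) : 0 < tau n ->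
  0 < tau n.+1 <= tau n * Num.sqrt (1 + theta n).
Proof.
move=> tn; have [m [t [w [/andP[t0 t1] tS _ _ [_ -> _]]]]] :=
  pdal_linesearch xyP (ltn0Sn n).
move: mu01 => /andP[mu0 mu1].
have tP i : (i <= m)%N -> 0 < t i <= t 0%N.
  elim: i => [_|i IH im]; first by rewrite lexx andbT (lt_le_trans tn).
  have /andP[ti0 tile] := IH (ltnW im).
  rewrite tS// mulr_gt0//= (le_trans _ tile)// ger_pMl// ltW//.
have /andP[-> tm] := tP m (leqnn m).
exact: le_trans tm t1.
Qed.

Lemma tau_gt0 (n : nat) : 0 < tau n.
Proof.
elim: n => [|n IH]; first exact: pdal_tau0 xyP.
by have /andP[] := linesearch_pos_le IH.
Qed.

Lemma thetaE (n : nat) : theta n.+1 = tau n.+1 / tau n.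
Proof. exact: (pdal_theta xyP (ltn0Sn n)). Qed.

Lemma theta_gt0 (n : nat) : 0 < theta n.
Proof.
case: n => [|n]; first by rewrite (pdal_theta0 xyP).
by rewrite thetaE divr_gt0 // tau_gt0.
Qed.

Lemma tauE (n : nat) : tau n.+1 = theta n.+1 * tau n.
Proof. by rewrite thetaE divfK// gt_eqF// tau_gt0. Qed.

Lemma sqr_theta_le (n : nat) : theta n.+1 ^+ 2 <= 1 + theta n.
Proof.
have /andP[_] := linesearch_pos_le (tau_gt0 n).
rewrite tauE mulrC ler_pM2l ?tau_gt0// => th.
have t1 : 0 <= 1 + theta n by rewrite addr_ge0// ltW// theta_gt0.
by rewrite -(sqr_sqrtr t1) ler_pXn2r// nnegrE ?sqrtr_ge0// ltW// theta_gt0.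
Qed.

(** [theta_n <= 2] gives [theta_{n+1}^2 <= 3 < 4]. *)
Lemma theta_le2 (n : nat) : theta n <= 2.
Proof.
elim: n => [|n IH]; first by rewrite (pdal_theta0 xyP) ler1n.
have := sqr_theta_le n; have := theta_gt0 n.+1; nra.
Qed.

Lemma primal_prox (n : nat) :
  is_prox (fun z => (tau n)%:E * g z)%E (x n - tau n *: Ks (y n.+1)) (x n.+1).
Proof. exact: (pdal_primal xyP (ltn0Sn n)). Qed.

Lemma dual_prox (n : nat) :
  is_prox (fun z => (beta * tau n.+1)%:E * fs z)%E
    (y n.+1 + (beta * tau n.+1) *:
       (K (x n.+1 + theta n.+1 *: (x n.+1 - x n)) - dh (y n.+1))) (y n.+2).
Proof.
have [m [t [w [_ _ tr _ [_ tE yE]]]]] := pdal_linesearch xyP (ltn0Sn n).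
have := tr _ (leqnn m); rewrite /trial_step /= -tE -yE.
by rewrite -/(theta n.+1) thetaE.
Qed.

Lemma stop_accepted (n : nat) :
  stopping_test dotY Ks h dh beta delta (y n.+1) (tau n.+1) (y n.+2).
Proof.
by have [m [t [w [_ _ _ _ [st -> ->]]]]] := pdal_linesearch xyP (ltn0Sn n).
Qed.

Lemma gx_fin (n : nat) : g (x n.+1) \is a fin_num.
Proof. exact: prox_fin_num properg (tau_gt0 n) (primal_prox n). Qed.

Lemma fy_fin (n : nat) : fs (y n.+2) \is a fin_num.
Proof.
apply: prox_fin_num properfs _ (dual_prox n).
by rewrite mulr_gt0// tau_gt0.
Qed.

Lemma primal_variational (n : nat) (z : X) : g z \is a fin_num ->
  tau n * (fine (g (x n.+1)) - fine (g z)) <=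
  dotX ((x n.+1 - x n) + tau n *: Ks (y n.+1)) (z - x n.+1).
Proof.
move=> gz; have := prox_variational normX properg convexg (tau_gt0 n)
  (primal_prox n) gz.
by rewrite opprB addrA addrAC.
Qed.

Lemma dual_variational (n : nat) (z : Y) : fs z \is a fin_num ->
  beta * tau n.+1 * (fine (fs (y n.+2)) - fine (fs z)) <=
  dotY ((y n.+2 - y n.+1) - (beta * tau n.+1) *:
       (K (x n.+1 + theta n.+1 *: (x n.+1 - x n)) - dh (y n.+1))) (z - y n.+2).
Proof.
move=> fz; have bt : 0 < beta * tau n.+1 by rewrite mulr_gt0// tau_gt0.
have := prox_variational normY properfs convexfs bt (dual_prox n) fz.
by rewrite opprD addrA.
Qed.

(* By convexity of [h] at both ends, the Bregman distance of [h] is at most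
   [L * |y' - y1| ^+ 2], so every trial value below a fixed threshold is
   accepted. *)
Lemma small_step_accepted (t : R) (y1 y' : Y) : 0 < t ->
  t <= delta / (1 + beta * (kn ^+ 2 + 2 * L)) ->
  stopping_test dotY Ks h dh beta delta y1 t y'.
Proof.
move=> t0; set c := 1 + _.
move: delta01 => /andP[d0 d1].
have c1 : 1 <= c.
  by rewrite lerDl mulr_ge0 ?(ltW beta_gt0)// addr_ge0 ?exprn_ge0// mulr_ge0.
rewrite ler_pdivlMr ?(lt_le_trans _ c1)// => tc.
(* This allows [t^2 * beta] to be replaced by [t * beta], so that a bound linear in [t] suffices. *)
have t1 : t <= 1.
  by nra.
rewrite /stopping_test -linearB.
have hB : h y' - h y1 - dotY (dh y1) (y' - y1) <= L * `|y' - y1| ^+ 2.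
  have := grad_le y' y1.
  have := le_trans (ler_norm _) (dot_le_norm normY (dh y' - dh y1) (y' - y1)).
  have := ler_wpM2r (normr_ge0 (y' - y1)) (dh_lip y' y1).
  rewrite -mulrA -expr2 dotDl dotNl -(opprB y' y1) dotNr.
  lra.
have hK : `|Ks (y' - y1)| ^+ 2 <= kn ^+ 2 * `|y' - y1| ^+ 2.
  by rewrite -exprMn ler_pXn2r ?nnegrE ?mulr_ge0// Ks_le.
set n2 := `|y' - y1| ^+ 2 in hB hK *.
have n20 : 0 <= n2 by rewrite exprn_ge0.
have tb : 0 <= t * beta by rewrite mulr_ge0 // ltW.
have ttb : t * (t * beta) <= t * beta by rewrite ger_pMl// mulr_gt0.
have e1 := ler_wpM2l (mulr_ge0 (ltW t0) tb) hK.
have kn2 : 0 <= kn ^+ 2 * n2 by rewrite mulr_ge0// exprn_ge0.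
have e2 := ler_wpM2r kn2 ttb.
have e3 := ler_wpM2l tb hB.
have e4 := ler_wpM2r n20 tc.
have tn : 0 <= t * n2 by rewrite mulr_ge0 // ltW.
move: e4; rewrite /c => e4.
lra.
Qed.

(** A first trial that is accepted is at least the previous step size; otherwise the last rejected
    trial exceeds [c0], and the accepted value is [mu] times it. *)
Lemma tau_bounded_below : exists2 c, 0 < c & forall n, c <= tau n.
Proof.
move: (mu01) (delta01) => /andP[mu0 mu1] /andP[d0 d1].
set c0 := delta / (1 + beta * (kn ^+ 2 + 2 * L)).
have c00 : 0 < c0.
  rewrite divr_gt0// ltr_pwDl// mulr_ge0 ?(ltW beta_gt0)//.
  by rewrite addr_ge0 ?exprn_ge0// mulr_ge0.
exists (Num.min (tau 0%N) (mu * c0)).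
  by rewrite lt_min tau_gt0 mulr_gt0.
elim=> [|n IH]; first by rewrite ge_min lexx.
have [m [t [w [/andP[t0 _] tS _ rej [_ tE _]]]]] :=
  pdal_linesearch xyP (ltn0Sn n).
case: m tS rej tE => [|m] tS rej ->; first exact: le_trans IH t0.
rewrite ge_min; apply/orP; right; rewrite tS// ler_pM2l// leNgt.
apply/negP => tc; apply: (rej m) => //; apply: small_step_accepted; last exact: ltW.
suff tP i : (i <= m)%N -> 0 < t i by exact: tP.
elim: i => [_|i Hi im]; first exact: lt_le_trans (tau_gt0 n) t0.
rewrite tS; last exact: (ltnW im).
by rewrite mulr_gt0// Hi// ltnW.
Qed.

Let saddle := saddle_point dotX dotY K Ks g fs h.
Let gap := primal_gap dotX Ks g.

(* Indices are shifted because [g (x 0)] may be infinite and [y 0] is junk. *)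
Definition weighted_gap (xh : X) (yh : Y) (n : nat) : R :=
  tau n.+1 * (1 + theta n.+1) * gap xh yh (x n.+1).

Definition energy (xh : X) (yh : Y) (n : nat) : R :=
  beta * `|x n.+2 - xh| ^+ 2 + `|y n.+2 - yh| ^+ 2
  + 2 * beta * weighted_gap xh yh n.

(* The slack in the step size bound: it vanishes exactly when [tau_{n+2}] is
   the largest admissible trial value. *)
Definition slack (n : nat) : R := 1 - theta n.+2 ^+ 2 / (1 + theta n.+1).

Definition extrapolation (n : nat) : X := theta n.+2 *: (x n.+2 - x n.+1).

Definition dual_increment (n : nat) : Y := y n.+3 - y n.+2.

Lemma theta1_gt0 (n : nat) : 0 < 1 + theta n.
Proof. by rewrite addr_gt0// theta_gt0. Qed.

Lemma slack_ge0 (n : nat) : 0 <= slack n.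
Proof.
by rewrite subr_ge0 ler_pdivrMr ?theta1_gt0// mul1r sqr_theta_le.
Qed.

Lemma weighted_gap_ge0 (xh : X) (yh : Y) (n : nat) :
  saddle xh yh -> 0 <= weighted_gap xh yh n.
Proof.
move=> /(saddle_pointP _ _ _ _ _ properg properfs)[_ _ gap0 _].
rewrite mulr_ge0//; last exact/gap0/gx_fin.
by rewrite mulr_ge0// ltW// ?tau_gt0 ?theta1_gt0.
Qed.

Lemma energy_ge0 (xh : X) (yh : Y) (n : nat) :
  saddle xh yh -> 0 <= energy xh yh n.
Proof.
move=> sad; have wg := weighted_gap_ge0 n sad.
have b0 := ltW beta_gt0.
apply: addr_ge0; last by rewrite mulr_ge0// mulr_ge0.
by rewrite addr_ge0 ?exprn_ge0// mulr_ge0 ?exprn_ge0.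
Qed.

(** This is [pdal_energy_increment] at [k = n + 2]. The old gap enters it with coefficient
    [tau_{n+2} theta_{n+2} = (1 - slack n) tau_{n+1} (1 + theta_{n+1})], whence the slack term. *)
Lemma energy_step (xh : X) (yh : Y) (n : nat) : saddle xh yh ->
  energy xh yh n.+1 +
    (beta * `|extrapolation n| ^+ 2 + (1 - delta) * `|dual_increment n| ^+ 2
     + 2 * beta * (slack n * weighted_gap xh yh n))
  <= energy xh yh n.
Proof.
move=> /(saddle_pointP _ _ _ _ _ properg properfs)[gxh fyh _ gap0].
have t1 := theta1_gt0 n.+1.
pose a := x n.+2 - x n.+1; pose b := x n.+3 - x n.+2.
pose e := x n.+2 - xh; pose u := y n.+3 - y n.+2; pose w := y n.+2 - yh.
have eb : x n.+3 - xh = e + b by rewrite /e /b [RHS]addrC addrA subrK.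
have uw : y n.+3 - yh = u + w by rewrite /u /w addrA subrK.
have ea : x n.+1 - xh = e - a by rewrite /e /a opprB [RHS]addrC addrA subrK.
have KE v q : dotY (K v) q = dotX v (Ks q) by exact: adjK.
(* The prox inequality at [x n.+2] is tested with both neighbouring iterates, the one at [x n.+3]
   with [xh]. *)
have i1 := primal_variational n.+1 (gx_fin n.+2).
have i2 := primal_variational n.+1 (gx_fin n).
have i3 := primal_variational n.+2 gxh.
have i4 := dual_variational n.+1 fyh.
have i5 := grad_le (y n.+2) yh.
have i6 := stop_accepted n.+1.
have i7 := gap0 _ (fy_fin n.+1).
rewrite -/a -/b in i1 i2 i3; rewrite -/u -/a in i4.
rewrite -(opprB (x n.+2) (x n.+1)) -/a in i2.
rewrite -(opprB (x n.+3) xh) eb tauE in i3.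
rewrite -(opprB (y n.+3) yh) uw tauE in i4.
rewrite -(opprB (y n.+2) yh) -/w dotNr in i5.
rewrite /stopping_test -/u tauE in i6.
rewrite /dual_gap uw KE in i7.
have KsE : Ks (u + w) = Ks (y n.+3) - Ks yh by rewrite -uw linearB.
have i4' : beta * (theta n.+2 * tau n.+1) *
    (fine (fs (y n.+3)) - fine (fs yh)) <=
    - dotY u (u + w) + beta * (theta n.+2 * tau n.+1) *
      (dotX (e + theta n.+2 *: a) (Ks (y n.+3) - Ks yh)
       + dotX xh (Ks (u + w)) - dotY (dh (y n.+2)) (u + w)).
  apply: le_trans i4 _; rewrite dotNr (dotDl dotY u) dotNl dotZl (dotDl dotY (K _)) dotNl KE KsE.
  have -> : x n.+2 + theta n.+2 *: a = (e + theta n.+2 *: a) + xh.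
    by rewrite addrAC subrK.
  rewrite (dotDl dotX (e + _)) le_eqVlt; apply/orP; left; apply/eqP; ring.
have i7' : 0 <= fine (fs (y n.+3)) + h (y n.+3) - fine (fs yh) - h yh
                - dotX xh (Ks (u + w)) := i7.
have := pdal_energy_increment normX normY beta_gt0 (tau_gt0 n.+1)
  (ltW (theta_gt0 n.+2)) i1 i2 i3 i4' i5 i6 i7'.
rewrite /energy /weighted_gap /gap /primal_gap eb uw ea -/e -/w -/u.
rewrite [tau n.+2]tauE /extrapolation /dual_increment -/a -/u.
have -> : slack n * (tau n.+1 * (1 + theta n.+1) *
    (fine (g (x n.+1)) - fine (g xh) + dotX (Ks yh) (e - a))) =
  (tau n.+1 * (1 + theta n.+1) - theta n.+2 * tau n.+1 * theta n.+2) *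
    (fine (g (x n.+1)) - fine (g xh) + dotX (Ks yh) (e - a)).
  by rewrite /slack; field; rewrite gt_eqF.
by move=> ?; lra.
Qed.

(** * Convergence *)

Lemma slack_weighted_gap_ge0 (xh : X) (yh : Y) (n : nat) :
  saddle xh yh -> 0 <= slack n * weighted_gap xh yh n.
Proof. by move=> sad; rewrite mulr_ge0 ?slack_ge0 ?weighted_gap_ge0. Qed.

Lemma energy_decrement_ge0 (xh : X) (yh : Y) (n : nat) : saddle xh yh ->
  [/\ 0 <= beta * `|extrapolation n| ^+ 2,
      0 <= (1 - delta) * `|dual_increment n| ^+ 2 &
      0 <= 2 * beta * (slack n * weighted_gap xh yh n)].
Proof.
move=> sad; have b0 := ltW beta_gt0.
have d1 : 0 <= 1 - delta by case/andP: delta01 => _ /ltW; rewrite subr_ge0.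
split; rewrite mulr_ge0 ?exprn_ge0 ?slack_weighted_gap_ge0// mulr_ge0//.
Qed.

Lemma energy_nonincreasing (xh : X) (yh : Y) : saddle xh yh ->
  {homo energy xh yh : n m / (n <= m)%N >-> m <= n}.
Proof.
move=> sad; apply/nonincreasing_seqP => n.
have [? ? ?] := energy_decrement_ge0 n sad.
by apply: le_trans (energy_step n sad); rewrite lerDl !addr_ge0.
Qed.

Lemma slack_weighted_gap_sum (xh : X) (yh : Y) (n : nat) : saddle xh yh ->
  \sum_(i < n) slack i * weighted_gap xh yh i
    <= (2 * beta)^-1 * energy xh yh 0%N.
Proof.
move=> sad; have b0 : 0 < 2 * beta by rewrite mulr_gt0.
rewrite ler_pdivlMl// mulr_sumr.
apply: (@descent_sum _ (energy xh yh)
  (fun i => 2 * beta * (slack i * weighted_gap xh yh i))) => m; first exact: energy_ge0.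
have [? ? ?] := energy_decrement_ge0 m sad.
by apply: le_trans (energy_step m sad); rewrite lerD2l lerDr addr_ge0.
Qed.

Lemma extrapolation_cvg0 (xh : X) (yh : Y) : saddle xh yh ->
  extrapolation n @[n --> \oo] --> 0.
Proof.
move=> sad; apply: cvg0_sqr_norm beta_gt0 _.
apply: (@descent_cvg0 _ (energy xh yh)) => n; first exact: energy_ge0.
  by have [] := energy_decrement_ge0 n sad.
have [? ? ?] := energy_decrement_ge0 n sad.
by apply: le_trans (energy_step n sad); rewrite lerD2l -addrA lerDl addr_ge0.
Qed.

Lemma dual_increment_cvg0 (xh : X) (yh : Y) : saddle xh yh ->
  dual_increment n @[n --> \oo] --> 0.
Proof.
move=> sad; have d1 : 0 < 1 - delta by case/andP: delta01; rewrite subr_gt0.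
apply: cvg0_sqr_norm d1 _.
apply: (@descent_cvg0 _ (energy xh yh)) => n; first exact: energy_ge0.
  by have [] := energy_decrement_ge0 n sad.
have [? ? ?] := energy_decrement_ge0 n sad.
apply: le_trans (energy_step n sad).
by rewrite lerD2l addrAC lerDr addr_ge0.
Qed.

Lemma iterates_bounded (xh : X) (yh : Y) : saddle xh yh ->
  exists M, forall n, `|x n.+2| <= M /\ `|y n.+2| <= M.
Proof.
move=> sad; pose E := energy xh yh 0%N.
exists (`|xh| + `|yh| + (1 + E / beta) + (1 + E)) => n.
have b0 := ltW beta_gt0.
have E0 : 0 <= E := energy_ge0 0 sad.
have En : energy xh yh n <= E := energy_nonincreasing sad (leq0n n).
have wg : 0 <= 2 * beta * weighted_gap xh yh n.
  by rewrite mulr_ge0 ?weighted_gap_ge0// mulr_ge0.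
(* The crude bound [r <= 1 + r^2] avoids square roots. *)
have sq (r c : R) : 0 <= r -> r ^+ 2 <= c -> r <= 1 + c by move=> r0 rc; nra.
have xn : 0 <= beta * `|x n.+2 - xh| ^+ 2 by rewrite mulr_ge0 ?exprn_ge0.
have yn : 0 <= `|y n.+2 - yh| ^+ 2 by rewrite exprn_ge0.
have xle : `|x n.+2 - xh| <= 1 + E / beta.
  apply: sq => //; rewrite ler_pdivlMr// mulrC.
  by apply: le_trans En; rewrite /energy -addrA lerDl addr_ge0.
have yle : `|y n.+2 - yh| <= 1 + E.
  apply: sq => //; apply: le_trans En.
  by rewrite /energy addrAC lerDr addr_ge0.
have Eb : 0 <= E / beta by rewrite divr_ge0.
have := ler_normD (x n.+2 - xh) xh; have := ler_normD (y n.+2 - yh) yh.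
rewrite !subrK => ? ?; have := normr_ge0 xh; have := normr_ge0 yh.
by move=> ? ?; split; lra.
Qed.

(** * Cluster points are saddle points *)

Lemma Ks_cvg (T : Type) (F : set_system T) {FF : Filter F} (v : T -> Y)
    (a : Y) :
  v t @[t --> F] --> a -> Ks (v t) @[t --> F] --> Ks a.
Proof.
suff Ks_cont : continuous Ks by move=> va; exact: continuous_cvg (Ks_cont a) va.
apply/linear_bounded_continuous/linear_boundedP.
by near=> r => w; apply: le_trans (Ks_le w) _; rewrite ler_wpM2r.
Unshelve. all: by end_near.
Qed.

Lemma dh_cvg (T : Type) (F : set_system T) {FF : Filter F} (v : T -> Y)
    (a : Y) :
  v t @[t --> F] --> a -> dh (v t) @[t --> F] --> dh a.
Proof.
move=> va; apply/subr_cvg0/norm_cvg0P.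
have hv : L * `|v t - a| @[t --> F] --> L * 0.
  by apply: cvgM; [exact: cvg_cst|exact/norm_cvg0P/subr_cvg0].
rewrite mulr0 in hv; apply: (squeeze_cvgr _ (cvg_cst 0) hv).
by apply: nearW => t; rewrite normr_ge0/= dh_lip.
Qed.

Lemma invr_tau_bounded : exists M, forall n, `|(tau n)^-1| <= M.
Proof.
have [c c0 ctau] := tau_bounded_below.
exists c^-1 => n; rewrite ger0_norm ?invr_ge0 ?(ltW (tau_gt0 n))//.
by rewrite lef_pV2 ?posrE ?tau_gt0.
Qed.

(** The energy controls [theta_k (x^k - x^{k-1})], not the bare increment; this identity expresses
    the residual of the prox step through it, with a bounded factor. *)
Lemma scaled_extrapolationE (n : nat) :
  (tau n.+2)^-1 *: extrapolation n = (tau n.+1)^-1 *: (x n.+2 - x n.+1).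
Proof.
rewrite /extrapolation scalerA thetaE mulrA mulVf ?mul1r//.
by rewrite gt_eqF// tau_gt0.
Qed.

Lemma primal_value_le (n : nat) (z : X) : g z \is a fin_num ->
  fine (g (x n.+2)) <= fine (g z) +
    dotX ((tau n.+2)^-1 *: extrapolation n + Ks (y n.+2)) (z - x n.+2).
Proof.
move=> gz; have := primal_variational n.+1 gz; have t0 := tau_gt0 n.+1.
rewrite scaled_extrapolationE -ler_pdivlMl// -lerBlDl => /le_trans; apply.
by rewrite -dotZl scalerDr scalerA mulVf ?gt_eqF// scale1r.
Qed.

Lemma dual_value_le (n : nat) (z : Y) : fs z \is a fin_num ->
  fine (fs (y n.+3)) <= fine (fs z) +
    dotY ((beta * tau n.+2)^-1 *: dual_increment n
          - (K (x n.+2 + extrapolation n) - dh (y n.+2))) (z - y n.+3).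
Proof.
move=> fz; have := dual_variational n.+1 fz.
have t0 : 0 < beta * tau n.+2 by rewrite mulr_gt0 ?tau_gt0.
rewrite -ler_pdivlMl// -lerBlDl => /le_trans; apply.
by rewrite -dotZl scalerBr scalerA mulVf ?gt_eqF// scale1r.
Qed.

(** In the limit the prox inequalities say that [- Ks ys] is a subgradient of [g] at [xs] and
    [K xs - dh ys] one of [fs] at [ys]; the gradient inequality for [h] then gives the dual half. *)
Lemma limit_is_saddle (xh : X) (yh : Y) (U : set_system nat)
    {UF : ProperFilter U} (xs : X) (ys : Y) :
  saddle xh yh -> \oo `<=` U ->
  x n.+2 @[n --> U] --> xs -> y n.+2 @[n --> U] --> ys -> saddle xs ys.
Proof.
move=> sad ooU xxs yys.
have [M tM] := invr_tau_bounded.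
have ex0 : extrapolation n @[n --> U] --> 0.
  exact: cvg_trans (cvg_app _ ooU) (extrapolation_cvg0 sad).
have dy0 : dual_increment n @[n --> U] --> 0.
  exact: cvg_trans (cvg_app _ ooU) (dual_increment_cvg0 sad).
have y3 : y n.+3 @[n --> U] --> ys.
  have -> : (fun n => y n.+3) = (fun n => dual_increment n + y n.+2).
    by apply/funext => n; rewrite subrK.
  by rewrite -[ys]add0r; apply: cvgD.
have gle z : g z \is a fin_num ->
    (g xs <= (fine (g z) + dotX (0 + Ks ys) (z - xs))%:E)%E.
  move=> gz.
  apply: (lsc_le_lim lscg xxs (b := fun n => fine (g z) +
    dotX ((tau n.+2)^-1 *: extrapolation n + Ks (y n.+2)) (z - x n.+2))).
    apply: cvgD; first exact: cvg_cst.
    apply: (cvg_dot normX); last by apply: cvgB => //; exact: cvg_cst.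
    apply: cvgD; last exact: Ks_cvg.
    exact: (@bounded_scale_cvg0 _ _ _ _ (fun n => (tau n.+2)^-1) M).
  apply: nearW => n; rewrite -(fineK (gx_fin n.+1)) lee_fin.
  exact: primal_value_le.
have fle z : fs z \is a fin_num ->
    (fs ys <= (fine (fs z) +
       dotY (0 - (K (xs + 0) - dh ys)) (z - ys))%:E)%E.
  move=> fz.
  apply: (lsc_le_lim lscfs y3 (b := fun n => fine (fs z) +
    dotY ((beta * tau n.+2)^-1 *: dual_increment n
          - (K (x n.+2 + extrapolation n) - dh (y n.+2))) (z - y n.+3))).
    apply: cvgD; first exact: cvg_cst.
    apply: (cvg_dot normY); last by apply: cvgB => //; exact: cvg_cst.
    apply: cvgB.
      apply: (@bounded_scale_cvg0 _ _ _ _ (fun n => (beta * tau n.+2)^-1)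
               (beta^-1 * M)) => // n.
      rewrite invfM normrM ger0_norm ?invr_ge0 ?(ltW beta_gt0)//.
      by rewrite ler_wpM2l ?invr_ge0 ?(ltW beta_gt0).
    apply: cvgB; last exact: dh_cvg.
    by apply: (continuous_cvg _ (@K_cont _)); apply: cvgD.
  apply: nearW => n; rewrite -(fineK (fy_fin n.+1)) lee_fin.
  exact: dual_value_le.
have [gN [x0 /(proper_fin_num properg) gx0]] := properg.
have [fN [y0 /(proper_fin_num properfs) fy0]] := properfs.
have gxs : g xs \is a fin_num.
  by apply: proper_fin_num => //; apply: le_lt_trans (gle _ gx0) (ltry _).
have fys : fs ys \is a fin_num.
  by apply: proper_fin_num => //; apply: le_lt_trans (fle _ fy0) (ltry _).
apply/(saddle_pointP _ _ _ _ _ properg properfs); split=> // [z gz|z fz].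
  have := gle z gz; rewrite -(fineK gxs) lee_fin add0r /primal_gap; lra.
have := fle z fz; rewrite -(fineK fys) lee_fin addr0 sub0r opprB dotDl dotNl.
have := grad_le ys z; rewrite /dual_gap; lra.
Qed.

(** Multiplying [primal_value_le] by [tau] frees the extrapolation term of its factor [1 / tau] but
    puts [tau] on the error in [Ks y], hence the need for [scaled_Ks_cvg0]. *)
Lemma weighted_gap_le (xs : X) (ys : Y) (n : nat) : saddle xs ys ->
  weighted_gap xs ys n.+1 <= (1 + theta n.+2) *
    (dotX (extrapolation n) (xs - x n.+2)
     + tau n.+2 * dotX (Ks (y n.+2 - ys)) (xs - x n.+2)).
Proof.
move=> /(saddle_pointP _ _ _ _ _ properg properfs)[gxs _ _ _].
have t0 := tau_gt0 n.+2.
rewrite /weighted_gap [tau _ * _]mulrC -mulrA ler_pM2l ?theta1_gt0//.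
have := primal_value_le n gxs.
have -> : Ks (y n.+2 - ys) = Ks (y n.+2) - Ks ys by exact: linearB.
move: (extrapolation n) => v.
rewrite /gap /primal_gap -(opprB xs (x n.+2)) dotNr.
move: (xs - x n.+2) => z; rewrite !dotDl dotNl dotZl.
move=> /(ler_wpM2l (ltW t0)); rewrite !mulrDr mulVKf ?gt_eqF//.
lra.
Qed.

Lemma scaled_Ks_increment_le (n : nat) :
  tau n.+2 * `|Ks (dual_increment n)| <= (1 + beta^-1) * `|dual_increment n|.
Proof.
have t0 := tau_gt0 n.+2; have b0 : 0 < beta^-1 by rewrite invr_gt0.
have := stop_accepted n.+1; rewrite /stopping_test -linearB -/(dual_increment n).
have := grad_le (y n.+2) (y n.+3); rewrite -/(dual_increment n) => gr.
move: delta01 => /andP[_ d1] st.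
rewrite -(@ler_pXn2r _ 2)// ?nnegrE ?mulr_ge0 ?addr_ge0 ?(ltW t0) ?(ltW b0)//.
set r := `|Ks _| in st *; set u := `|dual_increment n| in st *.
have u2 : 0 <= u ^+ 2 := sqr_ge0 u.
have h0 : 0 <= 2 * (beta * tau n.+2) *
    (h (y n.+3) - h (y n.+2) - dotY (dh (y n.+2)) (dual_increment n)).
  rewrite mulr_ge0 ?subr_ge0// mulr_ge0//.
  by rewrite mulr_ge0 ?(ltW beta_gt0) ?(ltW t0).
have tr : (tau n.+2 * r) ^+ 2 <= beta^-1 * u ^+ 2.
  rewrite ler_pdivlMl// exprMn.
  have : delta * u ^+ 2 <= u ^+ 2 by rewrite ler_piMl// ltW.
  lra.
(* [1 + beta^-1] replaces the square root of [beta^-1]. *)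
apply: le_trans tr _; rewrite exprMn ler_wpM2r//.
by nra.
Qed.

(* Once [tau] grows geometrically, the increments of [K^* y^k] are dominated by
   a geometric series with leading term of order [1 / tau]. *)
Lemma Ks_tail_le (N : nat) (eps : R) :
  (forall n, (N <= n)%N -> `|dual_increment n| <= eps) ->
  (forall n, (N <= n)%N -> 6 / 5 * tau n.+2 <= tau n.+3) ->
  forall n j, (N <= n)%N ->
  `|Ks (y (n + j).+2 - y n.+2)| <=
    6 * ((1 + beta^-1) * eps) * ((tau n.+2)^-1 - (tau (n + j).+2)^-1).
Proof.
move=> De tg n j Nn; set C := _ * eps.
elim: j => [|j IH]; first by rewrite addn0 !subrr raddf0 normr0 mulr0.
have Nnj : (N <= n + j)%N by rewrite (leq_trans Nn)// leq_addr.
have b0 : 0 < 1 + beta^-1 by rewrite addr_gt0// invr_gt0.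
have C0 : 0 <= C by rewrite mulr_ge0 ?(ltW b0)// (le_trans _ (De _ Nnj)).
rewrite addnS; set m := (n + j)%N in Nnj IH *.
have -> : y m.+3 - y n.+2 = dual_increment m + (y m.+2 - y n.+2).
  by rewrite addrA subrK.
rewrite raddfD; apply: le_trans (ler_normD _ _) _.
have tm := tau_gt0 m.+2; have tm3 := tau_gt0 m.+3.
have h1 : `|Ks (dual_increment m)| <= C * (tau m.+2)^-1.
  rewrite ler_pdivlMr// mulrC; apply: le_trans (scaled_Ks_increment_le m) _.
  by rewrite ler_wpM2l ?(ltW b0)// De.
(* Hence [1 / tau_{m+2}] is at most 6 times its decrease to [1 / tau_{m+3}]: the bound telescopes,
   and 6 is the constant of the statement. *)
have h2 : (tau m.+3)^-1 <= 5 / 6 * (tau m.+2)^-1.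
  rewrite (_ : 5 / 6 * _ = (6 / 5 * tau m.+2)^-1); last by rewrite invfM; field; rewrite gt_eqF.
  by rewrite lef_pV2 ?posrE ?tg// mulr_gt0.
have := ler_wpM2l C0 h2; lra.
Qed.

(** In the tail bound from [n] to [j], only [j] goes to its limit along [U]. The resulting estimate
    holds for all large [n], so the convergence is along [\oo]. *)
Lemma scaled_Ks_cvg0 (xh : X) (yh : Y) (U : set_system nat)
    {UF : ProperFilter U} (ys : Y) (N : nat) :
  saddle xh yh -> \oo `<=` U -> y n.+2 @[n --> U] --> ys ->
  (forall n, (N <= n)%N -> 6 / 5 * tau n.+2 <= tau n.+3) ->
  tau n.+2 * `|Ks (y n.+2 - ys)| @[n --> \oo] --> 0.
Proof.
move=> sad ooU yys tg; apply/cvgrPdist_le => e e0.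
have b0 : 0 < 6 * (1 + beta^-1) by rewrite mulr_gt0// addr_gt0// invr_gt0.
pose eps := e / (6 * (1 + beta^-1)).
have eps0 : 0 < eps by rewrite divr_gt0.
have := dual_increment_cvg0 sad => /cvgrPdist_le/(_ _ eps0)[N' _ N'e].
exists (maxn N N') => // n /=; rewrite geq_max => /andP[Nn N'n].
have t0 := tau_gt0 n.+2.
rewrite sub0r normrN ger0_norm ?mulr_ge0 ?(ltW t0)//.
rewrite mulrC -ler_pdivlMr//.
have tail j : (n <= j)%N -> `|Ks (y j.+2 - y n.+2)| <= e / tau n.+2.
  move=> nj; have := @Ks_tail_le n eps _ _ n (j - n) (leqnn n).
  rewrite subnKC// => /(_ _ _)/le_trans; apply.
  - by move=> i ni; have := N'e i (leq_trans N'n ni); rewrite /= sub0r normrN.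
  - by move=> i ni; apply: tg; exact: leq_trans Nn ni.
  have -> : 6 * ((1 + beta^-1) * eps) = e.
    by rewrite /eps mulrA mulrC divfK// gt_eqF.
  by rewrite ler_wpM2l ?(ltW e0)// gerBl invr_ge0 ltW// tau_gt0.
rewrite -normrN -raddfN opprB.
have hc : `|Ks (y j.+2 - y n.+2)| @[j --> U] --> `|Ks (ys - y n.+2)|.
  apply: cvg_norm; apply: Ks_cvg; apply: cvgB => //; exact: cvg_cst.
apply: (cvgr_to_le hc); apply: ooU; exists n => // j /= nj; exact: tail.
Qed.

(* [0.81 <= theta_{n+2}^2] gives [0.9 <= theta_{n+2}], whence
   [theta_{n+3}^2 >= 0.81 * 1.9 > 1.2^2]. *)
Lemma slack_small_growth (n : nat) :
  slack n <= 19 / 100 -> slack n.+1 <= 19 / 100 -> 6 / 5 * tau n.+2 <= tau n.+3.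
Proof.
have th1 := theta_gt0 n.+1; have th2 := theta_gt0 n.+2; have th3 := theta_gt0 n.+3.
have bound m : slack m <= 19 / 100 ->
    81 / 100 * (1 + theta m.+1) <= theta m.+2 ^+ 2.
  move=> sm; rewrite -ler_pdivlMr ?theta1_gt0//; rewrite /slack in sm; lra.
move=> /bound s0 /bound s1; rewrite [tau n.+3]tauE ler_pM2r ?tau_gt0//.
have t2 : 9 / 10 <= theta n.+2 by nra.
by nra.
Qed.

Lemma weighted_gap_cvg0_of_bounded_slack (xs : X) (ys : Y) (U : set_system nat)
    {UF : ProperFilter U} :
  (exists M : R, forall n, \sum_(i < n) slack i <= M) ->
  saddle xs ys -> \oo `<=` U -> y n.+2 @[n --> U] --> ys ->
  weighted_gap xs ys n @[n --> \oo] --> 0.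
Proof.
move=> [M sM] sad ooU yys.
have sl0 : slack n @[n --> \oo] --> 0.
  (* The remaining budget [M] minus the partial sum is nonnegative and drops by exactly
     [slack n]. *)
  apply: (@descent_cvg0 _ (fun n => M - \sum_(i < n) slack i)) => n.
  - by rewrite subr_ge0.
  - exact: slack_ge0.
  - by rewrite /= big_ord_recr/=; lra.
have s19 : 0 < 19 / 100 :> R by lra.
have [N _ Ns] : \forall n \near \oo, slack n <= 19 / 100.
  by apply: (cvgr_le 0).
have tg n : (N <= n)%N -> 6 / 5 * tau n.+2 <= tau n.+3.
  move=> Nn; apply: slack_small_growth; apply: Ns => //=.
  exact: leqW.
have q0 : tau n.+2 * `|Ks (y n.+2 - ys)| @[n --> \oo] --> 0.
  exact: scaled_Ks_cvg0 sad ooU yys tg.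
have [B xB] := iterates_bounded sad.
rewrite -(cvg_shiftS (weighted_gap xs ys)) /=.
pose D := `|xs| + B.
(* The factor 3 bounds [1 + theta n.+2]. *)
have hc : 3 * ((`|extrapolation n| + tau n.+2 * `|Ks (y n.+2 - ys)|) * D)
    @[n --> \oo] --> 3 * ((0 + 0) * D).
  apply: cvgM; first exact: cvg_cst.
  apply: cvgM; last exact: cvg_cst.
  apply: cvgD => //.
  apply/(norm_cvg0P extrapolation); exact: extrapolation_cvg0 sad.
rewrite addr0 mul0r mulr0 in hc.
apply: (squeeze_cvgr _ (cvg_cst 0) hc); apply: nearW => n.
rewrite weighted_gap_ge0//=; apply: le_trans (weighted_gap_le n sad) _.
have t0 := tau_gt0 n.+2.
have xD : `|xs - x n.+2| <= D.
  by apply: le_trans (ler_normB _ _) _; rewrite lerD2l; case: (xB n).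
have cs (v : X) : dotX v (xs - x n.+2) <= `|v| * D.
  apply: le_trans (ler_norm _) _; apply: le_trans (dot_le_norm normX _ _) _.
  by rewrite ler_wpM2l.
have c1 := cs (extrapolation n).
have c2 := ler_wpM2l (ltW t0) (cs (Ks (y n.+2 - ys))).
have D0 : 0 <= D by rewrite (le_trans _ xD).
have Q0 : 0 <= (`|extrapolation n| + tau n.+2 * `|Ks (y n.+2 - ys)|) * D.
  by rewrite mulr_ge0// addr_ge0// mulr_ge0// ltW.
have th2 := theta_le2 n.+2.
apply: (@le_trans _ _ ((1 + theta n.+2) *
    ((`|extrapolation n| + tau n.+2 * `|Ks (y n.+2 - ys)|) * D))).
  by rewrite ler_wpM2l ?(ltW (theta1_gt0 _))//; lra.
by rewrite ler_wpM2r//; lra.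
Qed.

(** The energy relative to the limit itself tends to 0 along [U], hence along [\oo] by monotonicity,
    and it dominates both squared distances. *)
Lemma pdal_cvg_along (xs : X) (ys : Y) (U : set_system nat)
    {UF : ProperFilter U} :
  saddle xs ys -> x n.+2 @[n --> U] --> xs -> y n.+2 @[n --> U] --> ys ->
  weighted_gap xs ys n @[n --> U] --> 0 ->
  x @ \oo --> xs /\ y @ \oo --> ys.
Proof.
move=> sad xxs yys wg0.
have EU : energy xs ys n @[n --> U] --> 0.
  have sq0 (V : normedModType R) (v : nat -> V) a :
      v n @[n --> U] --> a -> `|v n - a| ^+ 2 @[n --> U] --> 0.
    move=> /subr_cvg0/norm_cvg0P va; rewrite -(mulr0 0).
    exact: cvgM.
  have -> : 0 = beta * 0 + 0 + 2 * beta * 0 :> R by rewrite !mulr0 !addr0.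
  apply: cvgD; last by apply: cvgM => //; exact: cvg_cst.
  apply: cvgD; last exact: sq0.
  by apply: cvgM; [exact: cvg_cst|exact: sq0].
have E0 : energy xs ys n @[n --> \oo] --> 0.
  exact: nonincreasing_cvg0 (fun n => energy_ge0 n sad)
    (energy_nonincreasing sad) EU.
have wg n : 0 <= 2 * beta * weighted_gap xs ys n.
  by rewrite mulr_ge0 ?weighted_gap_ge0// mulr_ge0// ltW.
have xn n : 0 <= beta * `|x n - xs| ^+ 2.
  by rewrite mulr_ge0 ?exprn_ge0// ltW.
have yn n : 0 <= 1 * `|y n - ys| ^+ 2 by rewrite mul1r exprn_ge0.
split; rewrite -cvg_shiftS -cvg_shiftS /=; apply/subr_cvg0.
- apply: cvg0_sqr_norm beta_gt0 _; apply: (squeeze_cvgr _ (cvg_cst 0) E0).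
  by apply: nearW => n; rewrite xn/= /energy -addrA lerDl addr_ge0.
- apply: cvg0_sqr_norm ltr01 _; apply: (squeeze_cvgr _ (cvg_cst 0) E0).
  by apply: nearW => n; rewrite yn/= /energy addrAC mul1r lerDr addr_ge0.
Qed.

Lemma ultra_iterates_cvg (xh : X) (yh : Y) (U : set_system nat) :
  finite_dimensional X -> finite_dimensional Y -> saddle xh yh ->
  UltraFilter U -> \oo `<=` U ->
  exists xs ys, [/\ saddle xs ys, x n.+2 @[n --> U] --> xs &
    y n.+2 @[n --> U] --> ys].
Proof.
move=> finX finY sad UU ooU; have [M xyM] := iterates_bounded sad.
have [xs xxs] : exists l : X, x n.+2 @[n --> U] --> l.
  apply: (ultra_bounded_cvg normX (M := M)) => //.
  by apply: nearW => n; case: (xyM n).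
have [ys yys] : exists l : Y, y n.+2 @[n --> U] --> l.
  apply: (ultra_bounded_cvg normY (M := M)) => //.
  by apply: nearW => n; case: (xyM n).
exists xs, ys; split=> //; exact: limit_is_saddle sad ooU xxs yys.
Qed.

Lemma pdal_cvg (xh : X) (yh : Y) :
  finite_dimensional X -> finite_dimensional Y -> saddle xh yh ->
  exists xs ys, [/\ saddle xs ys, x @ \oo --> xs & y @ \oo --> ys].
Proof.
move=> finX finY sad.
have [bsl|ubsl] := pselect (exists M : R, forall n, \sum_(i < n) slack i <= M).
  have [U [UU ooU]] := ultraFilterLemma (eventually_filter).
  have [xs [ys [sads xxs yys]]] := ultra_iterates_cvg finX finY sad UU ooU.
  exists xs, ys.
  have wg0 : weighted_gap xs ys n @[n --> \oo] --> 0.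
    exact: weighted_gap_cvg0_of_bounded_slack bsl sads ooU yys.
  have [] := pdal_cvg_along sads xxs yys (cvg_trans (cvg_app _ ooU) wg0).
  by split.
(* This filter depends on the slacks alone, so it can be fixed before [xs] and [ys] are known; the
   summability of [slack * weighted_gap] is then applied to that limit. *)
have PF := cosummable_proper slack_ge0 ubsl.
have [U [UU cU]] := ultraFilterLemma PF.
have ooU : \oo `<=` U by apply: subset_trans cU; exact: (cofinite_cosummable slack_ge0).
have [xs [ys [sads xxs yys]]] := ultra_iterates_cvg finX finY sad UU ooU.
exists xs, ys.
have wg0 := cosummable_cvg0 slack_ge0 (fun n => weighted_gap_ge0 n sads)
  (fun n => slack_weighted_gap_sum n sads).
have [] := pdal_cvg_along sads xxs yys (cvg_trans (cvg_app _ cU) wg0).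
by split.
Qed.

End PDAL.

Theorem mainTheorem6 (R : realType) (X Y : normedModType R)
  (dotX : {dot X for idfun}) (dotY : {dot Y for idfun})
  (normX : norm_induced_by dotX) (normY : norm_induced_by dotY)
  (finX : finite_dimensional X) (finY : finite_dimensional Y)
  (K : {linear X -> Y}) (Ks : {linear Y -> X})
  (bndK : bounded_near K (nbhs (0 : X)))
  (adjK : is_adjoint dotX dotY K Ks)
  (g : X -> \bar R)
  (properg : proper_function g) (convexg : convex_efunction g)
  (lscg : lower_semicontinuous g)
  (f fs : Y -> \bar R)
  (convexf : convex_efunction f) (lscf : lower_semicontinuous f)
  (fsE : fs = fenchel_conjugate dotY f)
  (properfs : proper_function fs) (convexfs : convex_efunction fs)
  (lscfs : lower_semicontinuous fs)
  (h : Y -> R) (dh : Y -> Y) (Lh : R)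
  (convexh : convex_function [set: Y] h)
  (gradh : is_gradient dotY h dh)
  (lipdh : Lh.-lipschitz dh)
  (saddle_exists : exists xh yh, saddle_point dotX dotY K Ks g fs h xh yh)
  (beta mu delta : R)
  (beta_gt0 : 0 < beta) (mu01 : 0 < mu < 1) (delta01 : 0 < delta < 1)
  (x : nat -> X) (y : nat -> Y) (tau theta : nat -> R)
  (xy_generated :
    generated_by_PDAL dotY K Ks g fs h dh beta mu delta x y tau theta) :
  exists (xs : X) (ys : Y),
    [/\ saddle_point dotX dotY K Ks g fs h xs ys,
        x @ \oo --> xs & y @ \oo --> ys].
Proof.
have [xh [yh sad]] := saddle_exists.
have [kn kn0 Kle] : exists2 r, 0 < r & forall v, `|K v| <= r * `|v|.
  by apply: pinfty_ex_gt0; apply/linear_boundedP.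
(* From [|Ks v|^2 = <K (Ks v), v> <= kn |Ks v| |v|]. *)
have Ksle v : `|Ks v| <= kn * `|v|.
  have [->|Ksv] := eqVneq (Ks v) 0; first by rewrite normr0 mulr_ge0// ltW.
  rewrite -(@ler_pM2r _ `|Ks v|) ?normr_gt0// -expr2 (sqr_normE normX) -adjK.
  apply: le_trans (ler_norm _) _; apply: le_trans (dot_le_norm normY _ _) _.
  by rewrite mulrAC ler_wpM2r.
have K_cont : continuous K by apply/linear_bounded_continuous.
(* [Lh] carries no sign assumption, so a nonnegative Lipschitz constant is substituted. *)
have L0 : 0 <= Num.max Lh 0 by rewrite le_max lexx orbT.
have dh_lip a b : `|dh a - dh b| <= Num.max Lh 0 * `|a - b|.
  apply: le_trans (lipdh (a, b) _) _ => //=.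
  by rewrite ler_wpM2r// le_max lexx.
exact: (pdal_cvg normX normY adjK (ltW kn0) Ksle K_cont properg convexg lscg
  properfs convexfs lscfs L0 (fun a b => convex_gradient_le a b convexh gradh)
  dh_lip beta_gt0 mu01 delta01 xy_generated finX finY sad).
Qed.
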